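(* Let $\boldsymbol\theta$ be a torsion-free directive sequence with length sequence $(q_n)_{n\ge0}$, defined on a sequence of alphabets of bounded size, and let $h$ be its height. Let $\pi:X_{\boldsymbol\theta}\to Z:=\mathbb Z_{(q_n)}\times\mathbb Z/h\mathbb Z$ be the maximal equicontinuous factor map. Let $\mu$ be an ergodic $\sigma$-invariant Borel probability measure on $X_{\boldsymbol\theta}$. Suppose that $(X_{\boldsymbol\theta},\sigma)$ is a regular extension of its maximal equicontinuous factor, i.e. $$\pi(\nu)\big(\{y\in Z:|\pi^{-1}(y)|=1\}\big)=1$$ for every $\sigma$-invariant Borel probability measure $\nu$ on $X_{\boldsymbol\theta}$ (where $\pi(\nu)$ is the pushforward of $\nu$), and that the column number satisfies $c(\boldsymbol\theta)=1$. Then $(X_{\boldsymbol\theta},\sigma)$ is uniquely ergodic, and $(X_{\boldsymbol\theta},\sigma,\mu)$ has discrete spectrum with continuous eigenfunctions.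
   Context: Alphabets are finite sets. A morphism $\theta:\mathcal A\to\mathcal B^+$ maps letters to non-empty words and is extended by concatenation to words and to $\mathcal A^{\mathbb Z}$ (with $\theta(x_0)$ starting at index $0$). $\sigma$ is the left shift. A directive sequence is a sequence $\boldsymbol\theta=(\theta^{(n)})_{n\ge 0}$ of morphisms $\theta^{(n)}:\mathcal A_{n+1}\to\mathcal A_n^+$; bounded size means $\sup_n|\mathcal A_n|<\infty$. Put $\theta^{[n,N)}=\theta^{(n)}\circ\cdots\circ\theta^{(N-1)}$. $X^{(n)}_{\boldsymbol\theta}=X^{(n)}$ is the set of $x\in\mathcal A_n^{\mathbb Z}$ all of whose finite subwords are subwords of $\theta^{[n,N)}(a)$ for some $N>n$ and $a\in\mathcal A_N$; $X_{\boldsymbol\theta}=X^{(0)}_{\boldsymbol\theta}$. $\boldsymbol\theta$ is constant-length with length sequence $(q_n)$ if $|\theta^{(n)}(a)|=q_n$ for all $n$ and all $a\in\mathcal A_{n+1}$; $p_0=1$, $p_n=q_0\cdots q_{n-1}$. $\boldsymbol\theta$ is injective if each $\theta^{(n)}$ is injective on letters. $\boldsymbol\theta$ is torsion-free if it is constant-length with length sequence $(q_n)$, $q_n>1$ for infinitely many $n$, each $(X^{(n)}_{\boldsymbol\theta},\sigma)$ is minimal, $X^{(0)}_{\boldsymbol\theta}$ is aperiodic (contains no $\sigma$-periodic point), and every prime dividing some $q_k$ divides $q_n$ for infinitely many $n$. Height: with $\mathbb Z_{(q_n)}=\varprojlim\mathbb Z/p_n\mathbb Z$, a torsion-free $\boldsymbol\theta$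 on alphabets of bounded size has maximal equicontinuous factor the rotation by $(1,1)$ on $\mathbb Z_{(q_n)}\times\mathbb Z/h\mathbb Z$ for some $h$ coprime to every $q_n$; $h$ is the height of $\boldsymbol\theta$. Pure base: with $h$ the height, fix $(u^{(n)})_{n\ge0}$ with $u^{(n)}\in X^{(n)}$ and $\theta^{(n)}(u^{(n+1)})=u^{(n)}$ for all $n$. Let $\mathcal W^{(n)}$ be the set of words of length $h$ appearing in $u^{(n)}$ at an index in $\{kh:k\ge0\}$, $\mathcal B^{(n)}$ an alphabet with a bijection $\bar\tau_n:\mathcal B^{(n)}\to\mathcal W^{(n)}$, $\tau_n=\bar\tau_n^{-1}$, both extended to concatenations. The pure base is $\bar{\boldsymbol\theta}=(\bar\theta^{(n)})_{n\ge0}$ with $\bar\theta^{(n)}:\mathcal B^{(n+1)}\to(\mathcal B^{(n)})^{q_n}$, $\bar\theta^{(n)}(b)=\tau_n(\theta^{(n)}(\bar\tau_{n+1}(b)))$. Injectivisation $\widehat{\boldsymbol\theta}$ of a constant-length directive sequence $\boldsymbol\theta$: let $\mathcal B_0=\mathcal A_0$, $\kappa_0=\mathrm{id}$. Recursively, put $\eta^{(n)}=\kappa_n\circ\theta^{(n)}:\mathcal A_{n+1}\to\mathcal B_n^{q_n}$ ($\kappa_n$ applied letterwise), let $\kappa_{n+1}:\mathcal A_{n+1}\to\mathcal B_{n+1}$ be the quotient map identifying $a,a'$ exactly when $\eta^{(n)}(a)=\eta^{(n)}(a')$, and let $\widehat\theta^{(n)}(b)=\eta^{(n)}(a)$ for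 any $a\in\kappa_{n+1}^{-1}(b)$; $\widehat{\boldsymbol\theta}=(\widehat\theta^{(n)})_{n\ge0}$. Column numbers: for a morphism of constant length $\ell$ write $\theta(a)=\theta_0(a)\cdots\theta_{\ell-1}(a)$. For injective $\boldsymbol\theta$ let $c(\boldsymbol\theta,m)=\inf_{n>m}\{|(\theta^{[m,n)})_j(\mathcal A_n)|:0\le j<p_n/p_m\}$ (non-decreasing in $m$) and $\bar c(\boldsymbol\theta)=\max_m c(\boldsymbol\theta,m)$; for non-injective $\boldsymbol\theta$, $\bar c(\boldsymbol\theta):=\bar c(\widehat{\boldsymbol\theta})$ (naïve column number). The column number is $c(\boldsymbol\theta):=\bar c(\bar{\boldsymbol\theta})$. $(X,\sigma,\mu)$ has discrete spectrum if the span of the measurable eigenfunctions ($f\in L^2(X,\mu)$ nonzero with $f\circ\sigma=\lambda f$ for some $\lambda\in S^1$) is dense in $L^2(X,\mu)$; it has discrete spectrum with continuous eigenfunctions if the continuous eigenfunctions span a dense subspace of $L^2(X,\mu)$. *)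

(* Defs.v *)
From HB Require Import structures.
From mathcomp Require Import all_boot all_order all_algebra.
From mathcomp Require Import all_classical all_reals all_analysis.
From mathcomp Require Import complex.

Set Implicit Arguments.
Unset Strict Implicit.
Unset Printing Implicit Defensive.

Import Order.TTheory GRing.Theory Num.Theory.
Import numFieldNormedType.Exports.

Local Open Scope classical_set_scope.
Local Open Scope ring_scope.

(** * Topological dynamics *)

Definition minimal (X : topologicalType) (f : X -> X) : Prop :=
  [set: X] !=set0 /\
  forall C : set X, closed C -> f @` C `<=` C -> C = set0 \/ C = setT.

Definition aperiodic (X : Type) (f : X -> X) : Prop :=
  forall (x : X) (k : nat), (0 < k)%N -> iter k f x <> x.

(** [equicontinuous] of function_spaces.v for the iterates of [f], written out
    because the library version asks for a pointed codomain. *)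
Definition equicontinuous_iterates (X : uniformType) (f : X -> X) : Prop :=
  forall (x : X) (E : set (X * X)), entourage E ->
    \forall y \near x, forall k : nat, E (iter k f x, iter k f y).

(** Compact Hausdorff, with [f] invertible and [{f^k : k in Z}] equicontinuous
    (in particular [f] is a homeomorphism). *)
Definition equicontinuous_system (X : uniformType) (f : X -> X) : Prop :=
  [/\ compact [set: X], hausdorff_space X &
      exists g : X -> X,
        [/\ cancel f g, cancel g f,
            equicontinuous_iterates f & equicontinuous_iterates g]].

Definition factor_map (X Y : topologicalType) (f : X -> X) (g : Y -> Y)
    (phi : X -> Y) : Prop :=
  [/\ continuous phi, range phi = setT & forall x, phi (f x) = g (phi x)].

Definition max_equicontinuous_factor_map (X : topologicalType) (Z : uniformType)
    (f : X -> X) (g : Z -> Z) (pi : X -> Z) : Prop :=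
  [/\ equicontinuous_system g, factor_map f g pi &
      forall (Y : uniformType) (k : Y -> Y) (phi : X -> Y),
        equicontinuous_system k -> factor_map f k phi ->
        exists2 psi : Z -> Y, factor_map g k psi & phi = psi \o pi].

(** * Measurable dynamics *)

(** [borel x0] is [T] with its Borel sigma-algebra.  The point [x0] is present
    only because measurable types are pointed in the library. *)
Definition borel (T : topologicalType) (x0 : T) : Type := T.

HB.instance Definition _ (T : topologicalType) (x0 : T) :=
  Topological.on (borel x0).
HB.instance Definition _ (T : topologicalType) (x0 : T) :=
  isPointed.Build (borel x0) x0.
HB.instance Definition _ (T : topologicalType) (x0 : T) :=
  @isMeasurable.Build (sigma_display (@open (borel x0))) (borel x0)
    <<s @open (borel x0) >> (@sigma_algebra0 _ setT _)
    (@sigma_algebraC (borel x0) _) (@sigma_algebra_bigcup _ setT _).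

Section Ergodic.
Context {R : realType} {d : measure_display} {X : measurableType d}.

Definition invariant_measure (mu : probability X R) (f : X -> X) : Prop :=
  forall A : set X, measurable A -> mu (f @^-1` A) = mu A.

Definition ergodic (mu : probability X R) (f : X -> X) : Prop :=
  forall A : set X, measurable A -> f @^-1` A = A ->
    mu A = 0%E \/ mu A = 1%E.

(** Uniqueness is on measurable sets: the library leaves the values of a
    measure unconstrained elsewhere. *)
Definition uniquely_ergodic (f : X -> X) : Prop :=
  exists2 mu : probability X R, invariant_measure mu f &
    forall nu : probability X R, invariant_measure nu f ->
      forall A : set X, measurable A -> nu A = mu A.

Definition L2norm (mu : probability X R) (f : X -> R[i]) : \bar R :=
  Lnorm mu 2%:E (fun x => (Normc.normc (f x))%:E).

Definition in_L2 (mu : probability X R) (f : X -> R[i]) : Prop :=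
  [/\ measurable_fun setT (fun x => complex.Re (f x)),
      measurable_fun setT (fun x => complex.Im (f x)) &
      (L2norm mu f < +oo)%E].

Definition eigenfunction (mu : probability X R) (s : X -> X)
    (f : X -> R[i]) : Prop :=
  [/\ in_L2 mu f,
      ~ {ae mu, forall x, f x = 0} &
      exists2 lambda : R[i], `|lambda| = 1 &
        {ae mu, forall x, f (s x) = lambda * f x}].

Definition spans_dense_L2 (mu : probability X R) (E : set (X -> R[i])) : Prop :=
  forall g : X -> R[i], in_L2 mu g -> forall eps : R, 0 < eps ->
    exists n : nat, exists c : 'I_n -> R[i], exists f : 'I_n -> X -> R[i],
      (forall i, E (f i)) /\
      (L2norm mu (fun x => (g x - \sum_(i < n) c i * f i x)%R) < eps%:E)%E.

End Ergodic.

Arguments uniquely_ergodic R {d X} f.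

Definition discrete_spectrum_continuous_eigenfunctions {R : realType}
    {T : topologicalType} {x0 : T} (mu : probability (borel x0) R)
    (s : T -> T) : Prop :=
  spans_dense_L2 mu
    [set f : T -> R[i] | eigenfunction mu s f
                         /\ continuous (f : T -> R[i]^o)].

(** * Directive sequences *)

Record directive_seq := DirectiveSeq {
  alphabet :> nat -> finType;
  morph : forall n, alphabet n.+1 -> seq (alphabet n);
  morph_neq0 : forall n a, morph (n := n) a <> [::]
}.
Arguments morph d n a : clear implicits.

Definition bounded_size (theta : directive_seq) : Prop :=
  exists K : nat, forall n, (#|theta n| <= K)%N.

Definition constant_length (theta : directive_seq) (q : nat -> nat) : Prop :=
  forall n (a : theta n.+1), size (morph theta n a) = q n.

Definition injective_seq (theta : directive_seq) : Prop :=
  forall n, injective (morph theta n).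

Definition plen (q : nat -> nat) (n : nat) : nat := (\prod_(i < n) q i)%N.

(** [morphs theta m k] is theta^[m, k + m). *)
Fixpoint morphs (theta : directive_seq) (m k : nat) :
    theta (k + m)%N -> seq (theta m) :=
  match k with
  | 0 => fun a => [:: a]
  | k'.+1 => fun a => flatten [seq morphs b | b <- morph theta (k' + m)%N a]
  end.
Arguments morphs theta m k a : clear implicits.

Definition fullshift (A : finType) :=
  prod_topology (fun _ : int => discrete_topology A).

Definition shiftZ (A : finType) (x : fullshift A) : fullshift A :=
  fun i => x (i + 1).

(** The word [x_i ... x_(i+l-1)]. *)
Definition subword (A : finType) (x : fullshift A) (i : int) (l : nat) : seq A :=
  mkseq (fun j => x (i + j%:Z)) l.

Definition language (theta : directive_seq) (n : nat) : set (seq (theta n)) :=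
  [set w | exists k a, (0 < k)%N /\ infix w (morphs theta n k a)].

Definition subshift (theta : directive_seq) (n : nat) :
    set (fullshift (theta n)) :=
  [set x | forall i l, language (subword x i l)].

Arguments subshift : clear implicits.

Lemma shift_subshift (theta : directive_seq) n (x : fullshift (theta n)) :
  subshift theta n x -> subshift theta n (shiftZ x).
Proof.
move=> Xx i l; have := Xx (i + 1) l.
by congr (language _); apply: eq_map => j; rewrite /shiftZ addrAC.
Qed.

Definition shift_on (theta : directive_seq) n (x : subshift theta n) :
    subshift theta n :=
  exist _ (shiftZ (val x)) (mem_set (shift_subshift (set_mem (valP x)))).

Definition torsion_free (theta : directive_seq) (q : nat -> nat) : Prop :=
  [/\ constant_length theta q,
      (forall N, exists2 n, (N <= n)%N & (1 < q n)%N),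
      (forall n, minimal (@shift_on theta n)),
      aperiodic (@shift_on theta 0) &
      forall p k, prime p -> (p %| q k)%N ->
        forall N, exists2 n, (N <= n)%N & (p %| q n)%N].

(** * Odometer and height *)

(** The inverse limit of the Z/p_n, with Z/p_n carried by ['I_(p_n)]. *)
Definition odometer (q : nat -> nat) :
    set (prod_topology (fun n => discrete_topology 'I_(plen q n))) :=
  [set z | forall n,
     nat_of_ord (z n.+1) = nat_of_ord (z n) %[mod plen q n]].

Arguments odometer : clear implicits.

Lemma odometer_succ q (z : prod_topology _) :
  odometer q z -> odometer q (fun n => ordS (z n)).
Proof.
move=> Zz n /=; have := Zz n; rewrite modn_mod modn_dvdm; last first.
  by rewrite /plen big_ord_recr dvdn_mulr.
by move=> e; rewrite -[(z n.+1).+1]addn1 -[(z n).+1]addn1 -modnDml e modnDml.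
Qed.

Definition cyclic (h : nat) := discrete_topology 'I_h.

(** Rotation by (1, 1): [ordS] adds 1 modulo the size of the ordinal type. *)
Definition rotation q h (y : odometer q * cyclic h) : odometer q * cyclic h :=
  (exist _ (fun n => ordS (val y.1 n))
     (mem_set (odometer_succ (set_mem (valP y.1)))),
   ordS y.2).

Definition is_height (theta : directive_seq) (q : nat -> nat) (h : nat) : Prop :=
  [/\ (0 < h)%N, (forall n, coprime h (q n)) &
      exists pi : subshift theta 0 -> odometer q * cyclic h,
        max_equicontinuous_factor_map (@shift_on theta 0) (@rotation q h) pi].

(** * Pure base *)

(** [u n] lies in the n-th subshift and is the image of [u n.+1]; as the
    morphism has constant length [q n] and the image of the letter at 0 starts at
    0, the image of the letter at [k] occupies the positions from [k * q n]. *)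
Definition coherent (theta : directive_seq) (q : nat -> nat)
    (u : forall n, fullshift (theta n)) : Prop :=
  forall n, subshift theta n (u n) /\
    forall k : int, subword (u n) (k * (q n)%:Z) (q n) = morph theta n (u n.+1 k).

Definition hwords (theta : directive_seq) (h : nat)
    (u : forall n, fullshift (theta n)) (n : nat) : set (seq (theta n)) :=
  [set w | exists k : nat, w = subword (u n) (k * h)%:Z h].
Arguments hwords {theta} h u n.

(** [tau n] is the bijection from the n-th alphabet of the pure base [bar] onto
    the words of length [h]; the last clause is theta-bar(b) =
    tau^-1(theta(tau(b))), with the inverse moved to the other side. *)
Definition pure_base (theta : directive_seq) (q : nat -> nat) (h : nat)
    (u : forall n, fullshift (theta n)) (bar : directive_seq)
    (tau : forall n, bar n -> seq (theta n)) : Prop :=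
  [/\ (forall n, set_bij [set: bar n] (hwords h u n) (tau n)),
      constant_length bar q &
      forall n (b : bar n.+1),
        flatten [seq tau n c | c <- morph bar n b] =
        flatten [seq morph theta n a | a <- tau n.+1 b]].

(** * Injectivisation and column numbers *)

(** The class of a letter under kappa_n; letters of level n + 1 are identified
    exactly when their images agree after applying kappa_n letterwise. *)
Fixpoint kappa (theta : directive_seq) (n : nat) : theta n -> {set theta n} :=
  match n with
  | 0 => fun a => finset.set1 a
  | n'.+1 => fun a => finset (fun a' =>
      [seq kappa b | b <- morph theta n' a'] ==
      [seq kappa b | b <- morph theta n' a])
  end.

Definition inj_alphabet (theta : directive_seq) (n : nat) : finType :=
  {C : {set theta n} | C \in codom (@kappa theta n)}.

Definition inj_kappa (theta : directive_seq) n (a : theta n) :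
    inj_alphabet theta n :=
  exist _ (kappa a) (codom_f (@kappa theta n) a).

(** [iinv] picks a letter [a] with [kappa a = C]. *)
Definition inj_morph (theta : directive_seq) n (C : inj_alphabet theta n.+1) :
    seq (inj_alphabet theta n) :=
  [seq inj_kappa b | b <- morph theta n (iinv (valP C))].

Lemma inj_morph_neq0 (theta : directive_seq) n (C : inj_alphabet theta n.+1) :
  inj_morph C <> [::].
Proof.
move/(congr1 size)/eqP; rewrite size_map size_eq0 => /eqP.
exact: morph_neq0.
Qed.

Definition injectivisation (theta : directive_seq) : directive_seq :=
  DirectiveSeq (@inj_morph_neq0 theta).

(** Minimum, over n = k + m > m and j < p_n / p_m, of the size of the j-th column
    of theta^[m, n).  [onth w j] is [Some] of the j-th letter of [w]. *)
Definition column_number_from (theta : directive_seq) (q : nat -> nat)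
    (m : nat) : nat :=
  infimum 0%N [set c | exists k j,
    [/\ (0 < k)%N, (j < plen q (k + m) %/ plen q m)%N &
        c = #|codom (fun a => onth (morphs theta m k a) j)| ] ].

(** The default value 0 of [supremum] is taken only when no maximum exists. *)
Definition naive_column_number (theta : directive_seq) (q : nat -> nat) : nat :=
  supremum 0%N (range (column_number_from
    (if `[< injective_seq theta >] then theta else injectivisation theta) q)).

(* Main.v *)
Require Import Defs.
From mathcomp Require Import all_boot all_order all_algebra.
From mathcomp Require Import all_classical all_reals all_analysis.
From mathcomp Require Import measurable_realfun complex separable cyclotomic.
From mathcomp Require Import ring lra.
From mathcomp Require cyclic.
Import Order.TTheory GRing.Theory Num.Theory.
Import numFieldNormedType.Exports HBNNSimple.
Local Open Scope classical_set_scope.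
Local Open Scope ring_scope.

Set Implicit Arguments.
Unset Strict Implicit.
Unset Printing Implicit Defensive.

(** Call level-[n] cell of [x] the image of [pi x] in Z/p_n x Z/h.  The rotation
    permutes the level-[n] cells in a single cycle (Chinese remainder theorem), so
    all invariant measures give every cell the same mass.  For a closed set [C]
    the unions of the level-[n] cells meeting [C] decrease, by compactness, to
    [pi^-1 (pi C)], which differs from [C] only by points in non-singleton fibres,
    a null set by regularity.  Hence the masses of closed sets are determined by
    those of the cells, which gives unique ergodicity; and indicators of closed
    sets, then of Borel sets, then all L2 functions are L2-limits of functions of
    the cell.  A function on Z/p_n x Z/h is a combination of characters, and the
    characters pull back to continuous eigenfunctions. *)

(** * L2 approximation by functions of the cell *)

Section CellApprox.
Context {d : measure_display} {T : measurableType d} {R : realType}.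
Context (mu : probability T R) (I : nat -> finType) (c : forall n, T -> I n).
Hypothesis c_meas : forall n i, measurable [set x | c n x = i].
Hypothesis c_refine : forall m n x y,
  (m <= n)%N -> c n x = c n y -> c m x = c m y.

(** The distance is kept squared to avoid roots; [sqdist_trans] then replaces the triangle
    inequality. *)
Definition sqdist (f g : T -> R) : \bar R :=
  (\int[mu]_x ((f x - g x) ^+ 2)%:E)%E.

Definition cell_approx (f : T -> R) : Prop :=
  forall e : R, 0 < e ->
    exists n (g : I n -> R), (sqdist f (fun x => g (c n x)) < e%:E)%E.

Lemma measurable_cell (A : set T) n :
  (forall x y, c n x = c n y -> A x -> A y) -> measurable A.
Proof.
move=> AP.
have -> : A = \bigcup_(i in [set i | exists2 x, A x & c n x = i])
              [set x | c n x = i].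
  apply/seteqP; split => [x Ax|x [i [y Ay <-]] /= /esym cxy].
    by exists (c n x) => //; exists x.
  exact: AP cxy Ay.
apply: fin_bigcup_measurable => //; exact: finite_finset.
Qed.

Lemma measurable_fun_cell n (g : I n -> R) :
  measurable_fun setT (fun x => g (c n x)).
Proof.
move=> _ Y mY; rewrite setTI; apply: (@measurable_cell _ n) => x y /= ->.
by [].
Qed.

(** By refinement the level-[n] label determines the level-[m] label, so approximations at different
    levels can be moved to a common one. *)
Lemma cell_lift (S : Type) m n (g : I m -> S) : (m <= n)%N ->
  exists g' : I n -> S, forall x, g' (c n x) = g (c m x).
Proof.
move=> mn.
pose P i (s : S) := forall x, c n x = i -> s = g (c m x).
have /choice[g' g'P] : forall i, exists s, (exists x, c n x = i) -> P i s.
  move=> i; have [[x xi]|nx] := pselect (exists x, c n x = i).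
    exists (g (c m x)) => _ y yi; congr g; apply: (@c_refine m n) => //.
    by rewrite xi yi.
  (* A label carried by no point may get any value; [T] is pointed, so [S] is inhabited. *)
  by have [s _] : exists s : S, True by [exists (g (c m point))]; exists s.
by exists g' => x; apply: g'P => //; exists x.
Qed.

Lemma measurable_sqdist (f g : T -> R) :
  measurable_fun setT f -> measurable_fun setT g ->
  measurable_fun setT (fun x => ((f x - g x) ^+ 2)%:E).
Proof.
move=> mf mg; apply/measurable_EFinP.
by apply: measurable_funX; apply: measurable_funB.
Qed.

(** Integrates [(a + b)^2 <= 2 * (a^2 + b^2)], the gap being [(a - b)^2]. *)
Lemma sqdist_trans (f g k : T -> R) (a b : R) :
  measurable_fun setT f -> measurable_fun setT g ->
  measurable_fun setT k -> (sqdist f g < a%:E)%E -> (sqdist g k < b%:E)%E ->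
  (sqdist f k < (2 * (a + b))%:E)%E.
Proof.
move=> mf mg mk fg gk.
apply: (@le_lt_trans _ _ (2%:E * (sqdist f g + sqdist g k))%E); last first.
  rewrite EFinM lte_pmul2l// EFinD.
  apply: lte_leD => //; last exact: ltW.
  rewrite ge0_fin_numE ?(lt_trans gk) ?ltry//.
  by apply: integral_ge0 => x _; rewrite lee_fin sqr_ge0.
rewrite /sqdist -ge0_integralD//; last 4 first.
- by move=> x _; rewrite lee_fin sqr_ge0.
- exact: measurable_sqdist.
- by move=> x _; rewrite lee_fin sqr_ge0.
- exact: measurable_sqdist.
rewrite -ge0_integralZl//; last 2 first.
- by apply: emeasurable_funD; exact: measurable_sqdist.
- by move=> x _; rewrite adde_ge0// lee_fin sqr_ge0.
apply: ge0_le_integral => //.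
- by move=> x _; rewrite lee_fin sqr_ge0.
- exact: measurable_sqdist.
- by apply: measurable_funeM; apply: emeasurable_funD; exact: measurable_sqdist.
move=> x _; rewrite -EFinD -EFinM lee_fin.
have := sqr_ge0 ((f x - g x) - (g x - k x)); nra.
Qed.

(** Puts the two errors on opposite sides, so that [sqdist_trans] applies with the zero function in
    the middle. *)
Lemma sqdistD (f g f' g' : T -> R) :
  sqdist (f \+ g) (f' \+ g') = sqdist (f \- f') (g' \- g).
Proof. by apply: eq_integral => x _ /=; congr ((_ ^+ 2)%:E); lra. Qed.

Lemma cell_approxD (f g : T -> R) : measurable_fun setT f -> measurable_fun setT g ->
  cell_approx f -> cell_approx g -> cell_approx (f \+ g).
Proof.
move=> mf mg fa ga e e0.
(* Two errors of [e / 4], doubled by [sqdist_trans], add up to [e]. *)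
have e4 : 0 < e / 4 by lra.
have [m [f1 Hf]] := fa _ e4; have [n [g1 Hg]] := ga _ e4.
have [f2 f2E] := cell_lift f1 (leq_maxl m n).
have [g2 g2E] := cell_lift g1 (leq_maxr m n).
exists (maxn m n), (fun i => f2 i + g2 i).
have -> : (fun x => f2 (c (maxn m n) x) + g2 (c (maxn m n) x)) =
   (fun x => f1 (c m x)) \+ (fun x => g1 (c n x)).
  by apply/funext => x /=; rewrite f2E g2E.
have -> : e = 2 * (e / 4 + e / 4) by lra.
rewrite sqdistD; apply: (@sqdist_trans _ (cst 0)) => //.
- by apply: measurable_funB => //; exact: measurable_fun_cell.
- by apply: measurable_funB => //; exact: measurable_fun_cell.
- by apply: le_lt_trans Hf; rewrite le_eqVlt; apply/orP; left; apply/eqP;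
  apply: eq_integral => x _ /=; rewrite subr0.
- by apply: le_lt_trans Hg; rewrite le_eqVlt; apply/orP; left; apply/eqP;
  apply: eq_integral => x _ /=; congr ((_)%:E); nra.
Qed.

Lemma cell_approxZ (k : R) (f : T -> R) : measurable_fun setT f ->
  cell_approx f -> cell_approx (fun x => k * f x).
Proof.
move=> mf fa e e0.
(* Adding 1 keeps the divisor positive when [k] is 0. *)
have k1 : 0 < k ^+ 2 + 1 by have := sqr_ge0 k; lra.
have [n [g Hg]] := fa _ (divr_gt0 e0 k1).
exists n, (fun i => k * g i).
have -> : sqdist (fun x => k * f x) (fun x => k * g (c n x)) =
    ((k ^+ 2)%:E * sqdist f (fun x => g (c n x)))%E.
  rewrite -ge0_integralZl//; last 3 first.
  - by apply: measurable_sqdist => //; exact: measurable_fun_cell.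
  - by move=> x _; rewrite lee_fin sqr_ge0.
  - by rewrite lee_fin sqr_ge0.
  by apply: eq_integral => x _; rewrite -EFinM -exprMn mulrBr.
apply: (@le_lt_trans _ _ ((k ^+ 2 + 1)%:E * sqdist f (fun x => g (c n x)))%E).
  apply: lee_pmul => //.
  - by rewrite lee_fin sqr_ge0.
  - by apply: integral_ge0 => x _; rewrite lee_fin sqr_ge0.
  - by rewrite lee_fin; lra.
by rewrite muleC -lte_pdivlMr.
Qed.

Lemma cell_approx_sum (J : Type) (r : seq J) (f : J -> T -> R) :
  (forall j, measurable_fun setT (f j)) -> (forall j, cell_approx (f j)) ->
  cell_approx (fun x => \sum_(j <- r) f j x).
Proof.
move=> mf fa; elim: r => [|j r IH].
  move=> e e0; exists 0%N, (cst 0).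
  by rewrite /sqdist integral0_eq// => x _ /=; rewrite big_nil subr0 expr0n.
under eq_fun do rewrite big_cons.
apply: cell_approxD => //; exact: measurable_sum.
Qed.

(** Dominated convergence for the squared errors turns a.e. convergence into L2 convergence, and L2
    limits of approximable functions are approximable. *)
Lemma cell_approx_cvg (f : T -> R) (f_ : nat -> T -> R) (G : T -> R) :
  measurable_fun setT f -> (forall k, measurable_fun setT (f_ k)) ->
  (forall k, cell_approx (f_ k)) ->
  {ae mu, forall x, f_ k x @[k --> \oo] --> f x} ->
  mu.-integrable setT (EFin \o G) ->
  (forall k x, (f x - f_ k x) ^+ 2 <= G x) ->
  cell_approx f.
Proof.
move=> mf mf_ fa cvf iG fG e e0.
have [] := @dominated_convergence _ T R mu setT measurableT
  (fun k x => ((f x - f_ k x) ^+ 2)%:E) (cst 0%E) (EFin \o G)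
  (fun k => measurable_sqdist mf (mf_ k)) (measurable_cst _) _ iG _.
- apply: filterS cvf => x fx _.
  have : (f x - f_ k x) ^+ 2 @[k --> \oo] --> (0 : R).
    rewrite [X in _ --> X](_ : 0 = (f x - f x) ^+ 2); last by rewrite subrr expr0n.
    rewrite expr2; under eq_fun do rewrite expr2.
    by apply: cvgM; apply: cvgB => //; exact: cvg_cst.
  by move=> sq0; apply: cvg_EFin => //; exact: nearW.
- by apply: aeW => x k _ /=; rewrite lee_fin ger0_norm ?sqr_ge0.
move=> _ + _; have e4 : 0 < e / 4 by lra.
move=> /fine_cvgP[fin /cvgrPdist_lt/(_ _ e4) lt4].
have [k Hk] : exists k, (sqdist f (f_ k) < (e / 4)%:E)%E.
  have [k [finSk]] := filter_ex (filterI fin lt4).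
  rewrite sub0r normrN => /(le_lt_trans (ler_norm _)).
  rewrite -lte_fin fineK// => ltk; exists k; move: ltk.
  congr (_ < _)%E; apply: eq_integral => x _ /=.
  by rewrite subr0 ger0_norm ?sqr_ge0.
have [n [g Hg]] := fa k _ e4.
exists n, g.
have -> : e = 2 * (e / 4 + e / 4) by lra.
by apply: (@sqdist_trans _ (f_ k)) => //; exact: measurable_fun_cell.
Qed.

Lemma cell_approx_indic_cvg (A : set T) (A_ : nat -> set T) :
  measurable A -> (forall k, measurable (A_ k)) ->
  (forall k, cell_approx \1_(A_ k)) ->
  {ae mu, forall x, \1_(A_ k) x @[k --> \oo] --> (\1_A x : R)} ->
  cell_approx \1_A.
Proof.
move=> mA mA_ aA_ cvA.
apply: (@cell_approx_cvg _ (fun k => \1_(A_ k)) (cst 1)) => //.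
  exact: finite_measure_integrable_cst.
by move=> k x /=; rewrite !indicE; do 2 case: (_ \in _); rewrite /=; nra.
Qed.

Lemma cell_approx_indicC (A : set T) : cell_approx \1_A -> cell_approx \1_(~` A).
Proof.
move=> aA e e0; have [n [g Hg]] := aA e e0.
exists n, (fun i => 1 - g i); move: Hg; congr (_ < _)%E.
apply: eq_integral => x _; congr (_ %:E); rewrite !indicE in_setC.
by case: (_ \in _) => /=; ring.
Qed.

Lemma cell_approx_cell (A : set T) n :
  (forall x y, c n x = c n y -> A x -> A y) -> cell_approx \1_A.
Proof.
(* The indicator of the labels realised in [A] is at distance exactly 0. *)
move=> AP e e0; exists n, (fun i => (`[< exists2 x, A x & c n x = i >])%:R).
rewrite /sqdist integral0_eq// => x _; rewrite indicE.
suff -> : (x \in A) = `[< exists2 y, A y & c n y = c n x >].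
  by rewrite subrr expr0n.
apply/idP/asboolP => [/set_mem Ax|[y Ay cyx]]; first by exists x.
exact/mem_set/(AP _ _ cyx).
Qed.

(** Pi-lambda argument: the sets with approximable indicator are stable under complement and,
    through partial sums, under countable disjoint union. *)
Lemma cell_approx_indic (G : set_system T) : @measurable _ T = <<s G >> ->
  setI_closed G -> (forall A, G A -> cell_approx \1_A) ->
  forall A, measurable A -> cell_approx \1_A.
Proof.
move=> mG GI Ga A mA; have : <<s G >> A by rewrite -mG.
move: A {mA}; apply: (@dynkin_induction _ _ G (fun A => cell_approx \1_A)) => //.
- move=> e e0; exists 0%N, (cst 1).
  by rewrite /sqdist integral0_eq// => x _ /=; rewrite indicT /= subrr expr0n.
- by move=> S _; exact: cell_approx_indicC.
move=> F mF tF aF.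
pose f_ (n : nat) (x : T) : R := \sum_(0 <= k < n) \1_(F k) x.
have f_cvg x : f_ n x @[n --> \oo] --> (\1_(\bigcup_k F k) x : R).
  have : (f_ n x)%:E @[n --> \oo] --> (\1_(\bigcup_k F k) x)%:E.
    rewrite indic_bigcup//; under eq_fun do rewrite -sumEFin.
    by apply: is_cvg_nneseries => n _ _; rewrite lee_fin.
  by case/fine_cvgP.
apply: (@cell_approx_cvg _ f_ (cst 1)) => //.
- by apply: measurable_indic; exact: bigcup_measurable.
- by move=> k; apply: measurable_sum => j; exact: measurable_indic.
- by move=> k; apply: cell_approx_sum => // j; exact: measurable_indic.
- exact: aeW.
- exact: finite_measure_integrable_cst.
move=> k x /=.
(* The partial sums lie between 0 and the indicator of the union, so the squared error is at most
   1. *)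
have f0 : 0 <= f_ k x by apply: sumr_ge0.
have f1 : f_ k x <= \1_(\bigcup_k F k) x.
  rewrite -lee_fin indic_bigcup// -sumEFin.
  by apply: nneseries_lim_ge => n _; rewrite lee_fin.
move: f1; rewrite indicE; case: (_ \in _) => /=; nra.
Qed.

(** Simple functions increase to [f]; the error lies between 0 and [f], so its square is dominated
    by the integrable [f^2]. *)
Lemma cell_approx_ge0 (f : T -> R) :
  (forall A, measurable A -> cell_approx \1_A) ->
  measurable_fun setT f -> (forall x, 0 <= f x) ->
  mu.-integrable setT (fun x => ((f x) ^+ 2)%:E) -> cell_approx f.
Proof.
move=> aI mf f0 if2.
have mEf : measurable_fun setT (EFin \o f) by exact/measurable_EFinP.
pose g_ := nnsfun_approx measurableT mEf.
pose f_ (k : nat) : T -> R := g_ k.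
have f_cvg x : f_ k x @[k --> \oo] --> f x.
  have f0' y : setT y -> (0 <= (EFin \o f) y)%E by rewrite lee_fin.
  by have /fine_cvgP[_] := cvg_nnsfun_approx measurableT mEf f0' (Logic.I : setT x).
apply: (@cell_approx_cvg _ f_ (fun x => f x ^+ 2)) => //.
- move=> k.
  (* Writes the simple function as a finite combination of indicators of its level sets. *)
  rewrite /f_ (funext (fimfunEord (g_ k))).
  have mS (i : R) : measurable (g_ k @^-1` [set i]).
    by rewrite -[X in measurable X]setTI; exact: (@measurable_funPT _ _ _ _ (g_ k)).
  apply: cell_approx_sum => i.
    by apply: measurable_funM => //; exact: measurable_indic.
  by apply: cell_approxZ; [exact: measurable_indic|exact: aI].
- exact: aeW.
move=> k x.
have : f_ k x <= f x.
  rewrite -(cvg_lim _ (f_cvg x))//.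
  apply: (@nondecreasing_cvgn_le _ (f_^~ x)); last first.
    by apply/cvg_ex; exists (f x).
  by move=> m n mn; have /lefP := nd_nnsfun_approx measurableT mEf mn; apply.
have : 0 <= f_ k x by rewrite /f_.
have := f0 x; nra.
Qed.

Lemma cell_approx_L2 (f : T -> R) :
  (forall A, measurable A -> cell_approx \1_A) ->
  measurable_fun setT f ->
  mu.-integrable setT (fun x => ((f x) ^+ 2)%:E) -> cell_approx f.
Proof.
move=> aI mf if2.
have mf2 (g : T -> R) : measurable_fun setT g ->
    (forall x, (g x) ^+ 2 <= (f x) ^+ 2) ->
    mu.-integrable setT (fun x => ((g x) ^+ 2)%:E).
  move=> mg gf; apply: le_integrable if2 => //.
    by apply/measurable_EFinP; exact: measurable_funX.
  by move=> x _; rewrite /= lee_fin !ger0_norm ?sqr_ge0.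
have -> : f = f^\+ \+ (fun x => -1 * f^\- x).
  by rewrite -[LHS]funrposBneg; apply/funext => x /=; rewrite mulN1r.
apply: cell_approxD => //.
- exact: measurable_funrpos.
- by apply: measurable_funM => //; exact: measurable_funrneg.
- apply: cell_approx_ge0 => //; first exact: measurable_funrpos.
  apply: mf2; first exact: measurable_funrpos.
  by move=> x; rewrite /funrpos maxEle; case: ifP => _ //; rewrite expr0n sqr_ge0.
apply: cell_approxZ; first exact: measurable_funrneg.
apply: cell_approx_ge0 => //; first exact: measurable_funrneg.
apply: mf2; first exact: measurable_funrneg.
by move=> x; rewrite /funrneg maxEle; case: ifP => _ //;
  rewrite ?sqrrN// expr0n sqr_ge0.
Qed.

End CellApprox.

(** * Measures carried by the singleton fibres *)

Section SingletonFibres.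
Context (R : realType) (X : topologicalType) (x0 : X).
Context (I : nat -> finType) (c : forall n, X -> I n) (D : nat -> set X).
Hypothesis c_open : forall n i, open [set x | c n x = i].
Hypothesis c_refine : forall m n x y,
  (m <= n)%N -> c n x = c n y -> c m x = c m y.
Hypothesis X_compact : compact [set: X].
Hypothesis D_clopen : forall k, clopen (D k).
Hypothesis D_sep : forall x y, x <> y -> exists k, D k x /\ ~ D k y.

Local Notation B := (borel x0).

Definition cell_hull n (C : set X) : set X :=
  [set x | exists2 y, C y & c n y = c n x].

(** Fibres are expressed through labels alone: sharing all labels with [x] stands for having the
    same image in the factor. *)
Definition singleton_fibres : set X :=
  [set x | forall y, (forall n, c n y = c n x) -> y = x].

Lemma measurable_open (U : set X) : open U -> @measurable _ B U.
Proof. by move=> oU; exact: sub_sigma_algebra. Qed.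

Lemma measurable_closed (C : set X) : closed C -> @measurable _ B C.
Proof.
move=> cC; rewrite -[C]setCK; apply: (@measurableC _ B).
by apply: measurable_open; exact: closed_openC.
Qed.

Lemma measurable_hull n (C : set X) : @measurable _ B (cell_hull n C).
Proof.
apply: (@measurable_cell _ B I c _ _ n).
- by move=> m i; exact: measurable_open.
- by move=> x y cxy [z Cz czx]; exists z => //; rewrite czx.
Qed.

Lemma hull_sub m n (C : set X) : (m <= n)%N ->
  cell_hull n C `<=` cell_hull m C.
Proof. by move=> mn x [y Cy cyx]; exists y => //; exact: c_refine mn cyx. Qed.

(** Compactness: the sets [E n] are nonempty and decreasing, hence have a cluster point. It lies in
    [C] because [C] is closed, and in every cell of [x] because cells are open. *)
Lemma bigcap_hull (C : set X) x : closed C -> (\bigcap_n cell_hull n C) x ->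
  exists2 y, C y & forall n, c n y = c n x.
Proof.
move=> cC Hx; pose E n := C `&` [set y | c n y = c n x].
have FF : ProperFilter (filter_from [set: nat] E).
  apply: filter_from_proper.
    apply: filter_fromT_filter; first by exists 0%N.
    move=> i j; exists (maxn i j) => y [Cy cyx]; split; split => //.
      exact: c_refine (leq_maxl i j) cyx.
    exact: c_refine (leq_maxr i j) cyx.
  by move=> n _; have [y Cy cyx] := Hx n Logic.I; exists y.
have [p [_ clp]] := X_compact FF (@filterT _ _ FF).
exists p.
  apply: cC => A /(clp C A); rewrite setIC; apply.
  by exists 0%N => // y [].
move=> n; have [||z [[_ zx] zp]] := clp (E n) [set z | c n z = c n p].
- by exists n.
- by have := c_open (c n p); rewrite openE; apply.
by rewrite -zp zx.
Qed.

(* A countable union because the [D k] are countable: hence measurability. *)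
Lemma singleton_fibresC : ~` singleton_fibres =
  \bigcup_k ((\bigcap_n cell_hull n (D k)) `&`
             (\bigcap_n cell_hull n (~` D k))).
Proof.
apply/seteqP; split => [x|x [k _ [Dx nDx]] xS].
  move=> /existsNP[y /not_implyP[cyx yx]].
  have [k [Dy nDx]] := D_sep yx; exists k => //.
  by split => n _; [exists y|exists x].
have [oD cD] := D_clopen k.
have [y Dy /xS yx] := bigcap_hull cD Dx.
have [z nDz /xS zx] := bigcap_hull (open_closedC oD) nDx.
by apply: nDz; rewrite zx -yx.
Qed.

Lemma measurable_singleton_fibres : @measurable _ B singleton_fibres.
Proof.
rewrite -[singleton_fibres]setCK singleton_fibresC.
apply: (@measurableC _ B); apply: bigcup_measurable => k _.
by apply: measurableI; apply: bigcap_measurableType => n _; exact: measurable_hull.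
Qed.

Section OneMeasure.
Context (nu : probability B R).
Hypothesis nu_single : nu singleton_fibres = 1%E.

Lemma ae_singleton_fibres : {ae nu, forall x, singleton_fibres x}.
Proof.
exists (~` singleton_fibres); split => //.
  by apply: measurableC; exact: measurable_singleton_fibres.
rewrite probability_setC; last exact: measurable_singleton_fibres.
by rewrite nu_single subee.
Qed.

Lemma single_hull (C : set X) x : closed C -> singleton_fibres x ->
  (\bigcap_n cell_hull n C) x -> C x.
Proof. by move=> cC xS /(bigcap_hull cC)[y Cy /xS <-]. Qed.

(** The indicators of the hulls are functions of the cell. At a point with singleton fibre they are
    eventually equal to that of [C], since the hulls decrease; such points have full measure. *)
Lemma cell_approx_closed (C : set X) : closed C -> cell_approx nu c \1_C.
Proof.
move=> cC.
have c_meas n i : @measurable _ B [set x | c n x = i] by exact: measurable_open.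
apply: (cell_approx_indic_cvg c_meas (A_ := cell_hull^~ C)).
- exact: measurable_closed.
- by move=> n; exact: measurable_hull.
- move=> n; apply: (@cell_approx_cell _ B _ _ _ _ _ n).
  by move=> x y cxy [z Cz czx]; exists z => //; rewrite czx.
apply: (@filterS B _ (ae_filter_ringOfSetsType nu) _ _ _ ae_singleton_fibres).
move=> x xS.
have [Cx|nCx] := pselect (C x).
  apply: cvg_near_cst; apply: nearW => n.
  by rewrite !indicE !mem_set//; exists x.
have /existsNP[n /not_implyP[_ nx]] : ~ (\bigcap_n cell_hull n C) x.
  by move=> /(single_hull cC xS).
apply: cvg_near_cst; exists n => // m /= nm.
by rewrite !indicE !memNset// => /(hull_sub nm).
Qed.

Lemma cell_approx_borel (f : B -> R) : measurable_fun setT f ->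
  nu.-integrable setT (fun x => ((f x) ^+ 2)%:E) -> cell_approx nu c f.
Proof.
move=> mf if2.
have c_meas n i : @measurable _ B [set x | c n x = i] by exact: measurable_open.
apply: cell_approx_L2 => //; apply: (@cell_approx_indic _ B _ _ _ _ _ _ open) => //.
- exact: openI.
move=> U oU; rewrite -[U]setCK; apply: cell_approx_indicC.
by apply: cell_approx_closed; exact: open_closedC.
Qed.

(** Continuity from above along the hulls, whose intersection exceeds [C] only by points outside
    [singleton_fibres], a null set. *)
Lemma measure_closed_hull (C : set X) : closed C ->
  nu (cell_hull n C) @[n --> \oo] --> nu C.
Proof.
move=> cC; set H := \bigcap_n cell_hull n C.
have mH : @measurable _ B H.
  by apply: bigcap_measurableType => n _; exact: measurable_hull.
have mC : @measurable _ B C by exact: measurable_closed.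
have CH : C `<=` H by move=> x Cx n _; exists x.
have <- : nu H = nu C.
  rewrite -(setDUK CH); apply: measureU0 => //; first exact: (@measurableD _ B).
  have S0 : nu (~` singleton_fibres) = 0%E.
    rewrite probability_setC; last exact: measurable_singleton_fibres.
    by rewrite nu_single subee.
  apply: (subset_measure0 (T := B) _ _ _ S0).
  - exact: (@measurableD _ B).
  - by apply: (@measurableC _ B); exact: measurable_singleton_fibres.
  - by move=> x [Hx nCx] xS; apply: nCx; exact: single_hull Hx.
apply: (@nonincreasing_cvg_mu _ B) => //.
- by rewrite (le_lt_trans (probability_le1 _ _)) ?ltry//; exact: measurable_hull.
- by move=> n; exact: measurable_hull.
- by move=> m n mn; apply/subsetPset; exact: hull_sub.
Qed.

End OneMeasure.

(** A hull is a finite disjoint union of cells, so the measures agree on hulls, in the limit on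
    closed sets, by complement on open sets, and these form a generating pi-system. *)
Lemma eq_measure_singleton_fibres (nu1 nu2 : probability B R) :
  nu1 singleton_fibres = 1%E -> nu2 singleton_fibres = 1%E ->
  (forall n i, nu1 [set x | c n x = i] = nu2 [set x | c n x = i]) ->
  forall A, measurable A -> nu1 A = nu2 A.
Proof.
move=> s1 s2 cell12.
have hull12 n C : nu1 (cell_hull n C) = nu2 (cell_hull n C).
  have -> : cell_hull n C =
      \bigcup_(i in [set i | exists2 y, C y & c n y = i]) [set x | c n x = i].
    apply/seteqP; split => [x [y Cy cyx]|x [i [y Cy <-]] /= cxy].
      by exists (c n x) => //; exists y.
    by exists y.
  have fin (E : set (I n)) : finite_set E by exact: finite_finset.
  have triv (E : set (I n)) : trivIset E (fun i => [set x | c n x = i]).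
    by move=> i j _ _ [x [<- <-]].
  by rewrite !measure_fin_bigcup//;
    [by apply: eq_fsbigr => i _; exact: cell12|move=> i _; exact: measurable_open..].
apply: (@measure_unique _ _ B open (fun _ => setT)) => //.
- exact: openI.
- by move=> _; exact: openT.
- by apply: bigcup_const; exists 0%N.
- move=> U oU.
  have cU : closed (~` U) by exact: open_closedC.
  have nuC : nu1 (~` U) = nu2 (~` U).
    have := measure_closed_hull s1 cU; have := measure_closed_hull s2 cU.
    under eq_fun do rewrite -hull12.
    by move=> h2 h1; apply: cvg_unique h1 h2.
  have mU : @measurable _ B U by exact: measurable_open.
  have E (nu : probability B R) : nu U = (1 - nu (~` U))%E.
    by rewrite -{1}[U]setCK probability_setC//; exact: (@measurableC _ B).
  suff : nu1 U = nu2 U by [].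
  by rewrite (E nu1) (E nu2) nuC.
- by move=> _; exact: (le_lt_trans (probability_le1 nu1 measurableT) (ltry 1)).
Qed.

End SingletonFibres.

(** * Characters of Z/p x Z/h *)

(** In characteristic 0 the polynomial ['X^n - 1] is separable, so it has [n] distinct roots, and
    these include a primitive one. *)
Lemma prim_root_exists (C : numClosedFieldType) n : (0 < n)%N ->
  exists z : C, n.-primitive_root z.
Proof.
move=> n_gt0; pose p : {poly C} := 'X^n - 1.
have [r Dp] := closed_field_poly_normal p.
rewrite (monicP _) ?monicXnsubC // scale1r in Dp.
have rn1 : all n.-unity_root r.
  by apply/allP=> z; rewrite -root_prod_XsubC -Dp.
have sz_r : (n < (size r).+1)%N.
  by rewrite -(size_prod_XsubC r id) -Dp size_XnsubC.
have [|z] := hasP (cyclic.has_prim_root n_gt0 rn1 _ sz_r); last by exists z.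
by rewrite -separable_prod_XsubC -Dp separable_Xn_sub_1 // pnatr_eq0 -lt0n.
Qed.

(** For distinct [i] and [j] this is a geometric sum whose ratio differs from 1 but has [n]-th power
    1. *)
Lemma prim_root_orthogonality (F : fieldType) n (z : F) (i j : 'I_n) :
  n.-primitive_root z ->
  \sum_(a < n) (z ^+ i / z ^+ j) ^+ a = n%:R * (i == j)%:R.
Proof.
move=> zn; have z0 : z != 0 by rewrite (prim_root_eq0 zn) -lt0n (prim_order_gt0 zn).
have zj0 : z ^+ j != 0 by rewrite expf_neq0.
have [->|ij] := eqVneq i j.
  by under eq_bigr do rewrite divff// expr1n; rewrite sumr_const card_ord mulr1.
rewrite mulr0; set x := _ / _.
have x1 : x - 1 != 0.
  rewrite subr_eq0; apply: contraNneq ij => /(divr1_eq) /eqP.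
  by rewrite (eq_prim_root_expr zn) !modn_small.
apply: (mulfI x1); rewrite mulr0 -subrX1 /x expr_div_n -!exprM.
by rewrite ![(_ * n)%N]mulnC !exprM !(prim_expr_order zn) !expr1n divr1 subrr.
Qed.

(** Fourier inversion: after exchanging the sums, orthogonality in both factors leaves only the term
    [x = y]. *)
Lemma character_expansion (F : numFieldType) (p h : nat) (z w : F)
    (g : 'I_p * 'I_h -> F) (y : 'I_p * 'I_h) :
  p.-primitive_root z -> h.-primitive_root w ->
  g y = \sum_(k : 'I_p * 'I_h)
    ((p * h)%:R^-1 * \sum_x g x * ((z ^+ x.1) ^- k.1 * (w ^+ x.2) ^- k.2)) *
    ((z ^+ y.1) ^+ k.1 * (w ^+ y.2) ^+ k.2).
Proof.
move=> zp wh; have p0 := prim_order_gt0 zp; have h0 := prim_order_gt0 wh.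
under eq_bigr do rewrite -mulrA mulr_suml.
rewrite -mulr_sumr exchange_big /=.
have E x : \sum_(k : 'I_p * 'I_h) g x *
    ((z ^+ x.1) ^- k.1 * (w ^+ x.2) ^- k.2) *
    ((z ^+ y.1) ^+ k.1 * (w ^+ y.2) ^+ k.2) =
    g x * ((p * h)%:R * (y == x)%:R).
  have -> : (p * h)%:R * (y == x)%:R =
      (p%:R * (y.1 == x.1)%:R) * (h%:R * (y.2 == x.2)%:R) :> F.
    by rewrite -pair_eqE /pair_eq /= -mulnb !natrM mulrACA.
  rewrite -(prim_root_orthogonality _ _ zp) -(prim_root_orthogonality _ _ wh).
  rewrite big_distrlr/= pair_bigA/= mulr_sumr; apply: eq_bigr => k _.
  rewrite -mulrA; congr (_ * _); rewrite !expr_div_n.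
  by rewrite mulrC mulrACA.
under eq_bigr do rewrite E.
rewrite (bigD1 y)//= eqxx mulr1 big1 ?addr0; last first.
  by move=> x xy; rewrite eq_sym (negPf xy) !mulr0.
by rewrite mulrCA mulVf ?mulr1// pnatr_eq0 -lt0n muln_gt0 p0 h0.
Qed.

Lemma norm_prim_root (C : numFieldType) n (z : C) :
  n.-primitive_root z -> `|z| = 1.
Proof.
move=> zn; apply/eqP.
by rewrite -(pexpr_eq1 (prim_order_gt0 zn))// -normrX (prim_expr_order zn) normr1.
Qed.

(** * The cyclic motion of the cells *)

Definition rotate p h (y : 'I_p * 'I_h) : 'I_p * 'I_h := (ordS y.1, ordS y.2).

Lemma rotate_inj p h : injective (@rotate p h).
Proof.
have ordS_inj n : injective (@ordS n) by exact: can_inj (@ordSK n).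
move=> [a b] [a' b'] E.
by congr pair; [exact: ordS_inj (congr1 fst E)|exact: ordS_inj (congr1 snd E)].
Qed.

Lemma val_iter_ordS n k (i : 'I_n) : iter k (@ordS n) i = ((i + k) %% n)%N :> nat.
Proof.
elim: k => [|k IH] /=; first by rewrite addn0 modn_small.
by rewrite IH addnS -[in LHS]addn1 -[in RHS]addn1 modnDml.
Qed.

Lemma rotate_transitive p h (y y' : 'I_p * 'I_h) : coprime p h ->
  exists k, iter k (@rotate p h) y = y'.
Proof.
move=> ph; case: y y' => [a b] [a' b'].
(* The number of steps must be [a' - a] modulo [p] and [b' - b] modulo [h]; [p - a] and [h - b]
   stand for the negatives in [nat]. *)
exists (chinese p h (a' + (p - a)) (b' + (h - b))).
have iterE k : iter k (@rotate p h) (a, b) =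
      (iter k (@ordS p) a, iter k (@ordS h) b).
  by elim: k => //= k ->.
rewrite iterE; congr pair; apply/val_inj; rewrite /= val_iter_ordS -modnDmr.
  by rewrite chinese_modl// modnDmr addnCA subnKC ?modnDr ?modn_small// ltnW.
by rewrite chinese_modr// modnDmr addnCA subnKC ?modnDr ?modn_small// ltnW.
Qed.

(** By injectivity of [r] the preimage of the cell [r j] is the cell [j], so the mass is constant
    along the orbit of [r], which is all of [I]; the masses add up to 1. *)
Lemma invariant_cells {R : realType} {d} {X : measurableType d}
    (nu : probability X R) (s : X -> X) (I : finType) (c : X -> I) (r : I -> I) :
  invariant_measure nu s -> (forall i, measurable [set x | c x = i]) ->
  (forall x, c (s x) = r (c x)) -> injective r ->
  (forall i j, exists k, iter k r i = j) ->
  forall i, nu [set x | c x = i] = (#|I|%:R^-1)%:E.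
Proof.
move=> inv mc cs rI rT i.
have step j : nu [set x | c x = r j] = nu [set x | c x = j].
  rewrite -inv//; congr (nu _); apply/seteqP.
  by split => x /=; rewrite cs; [move/rI|move->].
have same j : nu [set x | c x = j] = nu [set x | c x = i].
  have [k <-] := rT i j; elim: k => //= k IH.
  by rewrite step.
have : nu setT = 1%E := probability_setT nu.
have -> : [set: X] = \bigcup_(j in [set: I]) [set x | c x = j].
  by apply/seteqP; split => // x _; exists (c x).
rewrite measure_fin_bigcup//; last 2 first.
- exact: finite_finset.
- by move=> j k _ _ [x [<- <-]].
rewrite (eq_fsbigr (fun=> nu [set x | c x = i])); last by move=> j _; exact: same.
rewrite fsbig_finite/=; last exact: finite_finset.
have fin : nu [set x | c x = i] \is a fin_num by exact: fin_num_measure.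
rewrite -(fineK fin) sumEFin => -[].
(* Passes to the enumeration of [I], so that the constant sum has [#|I|] terms. *)
rewrite (perm_big (index_enum I)) /=; last first.
  apply: uniq_perm; rewrite ?finmap.fset_uniq ?index_enum_uniq// => j.
  by rewrite mem_index_enum (in_fset_set finite_finset) mem_set.
rewrite sumr_const => E; congr EFin; apply: (@mulIf _ #|I|%:R).
  by rewrite pnatr_eq0 -lt0n; apply/card_gt0P; exists i.
by rewrite mulr_natr E mulVf// pnatr_eq0 -lt0n; apply/card_gt0P; exists i.
Qed.

(** * The L2 norm through real and imaginary parts *)

Section L2.
Context {R : realType} {d : measure_display} {X : measurableType d}.
Context (mu : probability X R).

Lemma L2normE (f : X -> R[i]) : (L2norm mu f `^ 2 =
  \int[mu]_x (complex.Re (f x) ^+ 2 + complex.Im (f x) ^+ 2)%:E)%E.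
Proof.
rewrite /L2norm poweR_Lnorm//; apply: eq_integral => x _ /=.
congr EFin; rewrite powR_mulrn ?normr_ge0//.
case: (f x) => a b /=.
by rewrite real_normK ?num_real// sqr_sqrtr// addr_ge0// sqr_ge0.
Qed.

Lemma L2norm_lt (f : X -> R[i]) (e : R) : 0 < e ->
  (L2norm mu f < e%:E)%E = (\int[mu]_x
    (complex.Re (f x) ^+ 2 + complex.Im (f x) ^+ 2)%:E < (e ^+ 2)%:E)%E.
Proof.
move=> e0; rewrite -L2normE.
have : (0 <= L2norm mu f)%E by exact: Lnorm_ge0.
case: (L2norm mu f) => [r|_|//].
  rewrite lee_fin => r0; rewrite poweR_EFin powR_mulrn// !lte_fin.
  by rewrite ltr_pXn2r// nnegrE ltW.
(* An infinite norm makes both inequalities false. *)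
by rewrite poweRyr ?pnatr_eq0// !ltNge !leey.
Qed.

Lemma in_L2_integrable (f : X -> R[i]) : in_L2 mu f ->
  mu.-integrable setT (fun x => (complex.Re (f x) ^+ 2)%:E) /\
  mu.-integrable setT (fun x => (complex.Im (f x) ^+ 2)%:E).
Proof.
move=> [mR mI fin].
have mR2 := measurable_funX 2 mR; have mI2 := measurable_funX 2 mI.
have iS : mu.-integrable setT
    (fun x => (complex.Re (f x) ^+ 2 + complex.Im (f x) ^+ 2)%:E).
  apply/integrableP; split.
    by apply/measurable_EFinP; exact: measurable_funD.
  rewrite (eq_integral
    (fun x => (complex.Re (f x) ^+ 2 + complex.Im (f x) ^+ 2)%:E)); last first.
    by move=> x _ /=; rewrite ger0_norm// addr_ge0// sqr_ge0.
  by rewrite -L2normE poweR_lty.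
split; apply: le_integrable iS => //; try exact/measurable_EFinP;
  by move=> x _ /=;
  rewrite lee_fin !ger0_norm ?addr_ge0 ?sqr_ge0// ?lerDl ?lerDr sqr_ge0.
Qed.
End L2.

(** * Discrete spectrum from the cells *)

Section Spectrum.
Context (R : realType) (X : topologicalType) (x0 : X).
Context (p : nat -> nat) (h : nat) (c : forall n, X -> 'I_(p n) * 'I_h).
Local Notation cell n := ('I_(p n) * 'I_h)%type.
Context (mu : probability (borel x0) R) (s : X -> X).
Hypothesis c_open : forall n i, open [set x | c n x = i].
Hypothesis c_refine : forall m n x y,
  (m <= n)%N -> c n x = c n y -> c m x = c m y.
Hypothesis c_shift : forall n x, c n (s x) = rotate (c n x).
Hypothesis dense : forall f : borel x0 -> R, measurable_fun setT f ->
  mu.-integrable setT (fun x => (f x ^+ 2)%:E) -> cell_approx mu c f.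

Let c_meas n i : @measurable _ (borel x0) [set x | c n x = i].
Proof. exact: measurable_open. Qed.

Let measurable_fun_c n (g : cell n -> R) :
  measurable_fun setT (fun x : borel x0 => g (c n x)).
Proof. exact: (@measurable_fun_cell _ (borel x0) R (fun n => cell n) c). Qed.

Lemma continuous_cell (Y : topologicalType) n (g : 'I_(p n) * 'I_h -> Y) :
  continuous (fun x => g (c n x)).
Proof.
move=> x U Ux; have := c_open (c n x); rewrite openE => /(_ x erefl).
by apply: filterS => y /= ->; exact: nbhs_singleton.
Qed.

(** The function has modulus 1, hence is in L2 and nowhere zero. One step of the rotation multiplies
    it by [z ^+ k.1 * w ^+ k.2]; wrapping around is harmless since [z] and [w] are roots of unity of
    the right orders. *)
Lemma eigenfunction_character n (z w : R[i]) (k : 'I_(p n) * 'I_h) :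
  (p n).-primitive_root z -> h.-primitive_root w ->
  eigenfunction mu s
    (fun x => (z ^+ (c n x).1) ^+ k.1 * (w ^+ (c n x).2) ^+ k.2).
Proof.
move=> zp wh; pose g (y : 'I_(p n) * 'I_h) := (z ^+ y.1) ^+ k.1 * (w ^+ y.2) ^+ k.2.
have g1 y : `|g y| = 1.
  by rewrite normrM !normrX (norm_prim_root zp) (norm_prim_root wh) !expr1n mulr1.
split.
- split.
  + exact: (@measurable_fun_c n (fun y => complex.Re (g y))).
  + exact: (@measurable_fun_c n (fun y => complex.Im (g y))).
  (* Any finite bound above the norm 1 would do, as [L2norm_lt] is strict. *)
  apply: (@lt_trans _ _ 2%:E); last exact: ltry.
  rewrite L2norm_lt//.
  rewrite (eq_integral (cst 1%E)).
    rewrite integral_cst// mul1e.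
    by apply: (le_lt_trans (probability_le1 mu measurableT)); rewrite lte_fin; lra.
  move=> x _ /=; congr EFin; apply: complexI.
  by rewrite add_Re2_Im2 g1 expr1n.
- case=> N [mN N0 sub].
  have NT : N = setT.
    apply/seteqP; split => // x _; apply: sub => /= gx.
    by have := g1 (c n x); rewrite /g gx normr0 => /esym/eqP; rewrite oner_eq0.
  by have := probability_setT mu; rewrite -NT N0 => /esym/eqP; rewrite onee_eq0.
exists (z ^+ k.1 * w ^+ k.2).
  by rewrite normrM !normrX (norm_prim_root zp) (norm_prim_root wh) !expr1n mulr1.
apply: aeW => x; rewrite c_shift /= (prim_expr_mod zp) (prim_expr_mod wh).
by rewrite !exprSr !exprMn mulrACA mulrC.
Qed.

(** Real and imaginary parts are approximated separately, with squared error below [e^2 / 2] each,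
    and lifted to a common level. The resulting complex function of the cell is a combination of
    characters. *)
Lemma discrete_spectrum_cells : (forall n, (0 < p n)%N) -> (0 < h)%N ->
  discrete_spectrum_continuous_eigenfunctions mu s.
Proof.
move=> p0 h0 g gL2 e e0.
have [mR mI _] := gL2; have [iR iI] := in_L2_integrable gL2.
have e2 : 0 < e ^+ 2 / 2 by rewrite divr_gt0// exprn_gt0.
have [m [g1 Hg1]] := dense mR iR e2.
have [n [g2 Hg2]] := dense mI iI e2.
have [g1' g1E] := @cell_lift _ (borel x0) (fun n => cell n) c
  c_refine _ _ _ g1 (leq_maxl m n).
have [g2' g2E] := @cell_lift _ (borel x0) (fun n => cell n) c
  c_refine _ _ _ g2 (leq_maxr m n).
set N := maxn m n in g1' g2' g1E g2E.
pose G (y : 'I_(p N) * 'I_h) : R[i] := (g1' y +i* g2' y)%C.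
have [z zp] := prim_root_exists R[i] (p0 N).
have [w wh] := prim_root_exists R[i] h0.
pose J : finType := ('I_(p N) * 'I_h)%type.
pose co (k : J) := (p N * h)%:R^-1 *
  \sum_x G x * ((z ^+ x.1) ^- k.1 * (w ^+ x.2) ^- k.2).
pose ch (k : J) (x : X) := (z ^+ (c N x).1) ^+ k.1 * (w ^+ (c N x).2) ^+ k.2.
exists #|J|, (fun i => co (enum_val i)), (fun i => ch (enum_val i)); split.
  move=> i; split; first exact: eigenfunction_character.
  exact: (@continuous_cell _ N (fun y =>
    (z ^+ y.1) ^+ (enum_val i).1 * (w ^+ y.2) ^+ (enum_val i).2)).
(* [enum_val] only reindexes the characters by ordinals, as [spans_dense_L2] asks. *)
have GE x : \sum_(i < #|J|) co (enum_val i) * ch (enum_val i) x = G (c N x).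
  rewrite (character_expansion G (c N x) zp wh).
  by rewrite -(big_enum_val (A := J) (fun k => co k * ch k x)); exact: eq_bigl.
under eq_fun do rewrite GE.
rewrite L2norm_lt//.
have -> : e ^+ 2 = e ^+ 2 / 2 + e ^+ 2 / 2 by lra.
rewrite EFinD; move: (lteD Hg1 Hg2); congr (_ < _)%E.
rewrite /sqdist -ge0_integralD//.
- apply: eq_integral => x _; rewrite -EFinD.
  by rewrite /G -g1E -g2E; case: (g x).
- by move=> x _; rewrite lee_fin sqr_ge0.
- exact: (measurable_sqdist mR (measurable_fun_c _)).
- by move=> x _; rewrite lee_fin sqr_ge0.
- exact: (measurable_sqdist mI (measurable_fun_c _)).
Qed.

End Spectrum.

(** * Topology of the subshift *)

(** A filter on the subtype is pushed to [T], where it clusters in [A]; open sets of the subtype are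
    traces of open sets of [T], so the cluster point pulls back. *)
Lemma compact_subtype (T : topologicalType) (A : set T) :
  compact A -> compact [set: A].
Proof.
move=> cA F PF _.
have PvF : ProperFilter ((val : A -> T) @ F) by exact: fmap_proper_filter.
have [|p [Ap clp]] := cA _ PvF.
  by apply: (@filterS _ F _ setT); [move=> x _; exact: set_valP|exact: filterT].
exists (exist _ p (mem_set Ap)); split => // B U FB.
move=> [_ [/= [W oW <-] /= Wp WU]].
have nW : nbhs p W by apply: open_nbhs_nbhs; split.
have FvB : (val @ F) (val @` B) by apply: (filterS (P := B)) => // b Bb; exists b.
have [_ [[b Bb <-] Wb]] := clp _ _ FvB nW.
by exists b; split => //; exact: WU.
Qed.

Section Subshift.
Context (theta : directive_seq) (n : nat).

Lemma letter_continuous (i : int) :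
  continuous (fun x : fullshift (theta n) => x i : discrete_topology (theta n)).
Proof.
exact: (@proj_continuous _ (fun _ : int => discrete_topology (theta n)) i).
Qed.

Lemma letter_clopen (i : int) (a : theta n) :
  clopen [set x : fullshift (theta n) | x i = a].
Proof.
split.
  apply: (@open_comp _ _ (fun x : fullshift (theta n) =>
    x i : discrete_topology _) [set a]); last exact: discrete_open.
  by move=> x _; exact: letter_continuous.
apply: (@closed_comp _ _ (fun x : fullshift (theta n) =>
  x i : discrete_topology _) [set a]); last exact: discrete_closed.
by move=> x _; exact: letter_continuous.
Qed.

(** Each word of [x] involves finitely many coordinates, so some point of the subshift agrees with
    [x] on that window. *)
Lemma closed_subshift : closed (subshift theta n).
Proof.
move=> x clx i l.
have nx : nbhs (x : fullshift (theta n))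
    [set y | forall j : 'I_l, y (i + j%:Z) = x (i + j%:Z)].
  apply: (@filter_forall _ 'I_l
    (fun j => [set y : fullshift (theta n) | y (i + j%:Z) = x (i + j%:Z)])
    _ (nbhs_filter (x : fullshift (theta n)))).
  move=> j; have [+ _] := letter_clopen (i + j%:Z) (x (i + j%:Z)).
  by rewrite openE; apply.
have [y [Xy xy]] := clx _ nx.
have <- : subword y i l = subword x i l; last exact: Xy.
by apply/eq_in_map => j; rewrite mem_iota => /andP[_ jl]; exact: (xy (Ordinal jl)).
Qed.

Lemma compact_subshift : compact [set: subshift theta n].
Proof.
apply: compact_subtype; apply: subclosed_compact closed_subshift _ _; last first.
  exact: subsetT.
have := @tychonoff int (fun _ => discrete_topology (theta n)) (fun _ => setT).
have -> : [set f : forall i : int, discrete_topology (theta n) |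
   forall i, [set: discrete_topology (theta n)] (f i)] = setT.
  by apply/seteqP.
by apply=> _; apply: finite_compact; exact: (@finite_finset (theta n)).
Qed.

(** Cylinders on one letter, indexed by [nat] through [pickle] to give the countable separating
    family of clopen sets. Codes of no pair yield [set0], which is clopen too. *)
Definition letter_set (k : nat) : set (subshift theta n) :=
  if unpickle k is Some (i, a) then [set x | val x i = a] else set0.

Lemma letter_set_clopen k : clopen (letter_set k).
Proof.
rewrite /letter_set; case: (unpickle k) => [[i a]|]; last exact: clopen0.
have [oa ca] := letter_clopen i a.
split; [apply: open_comp oa|apply: closed_comp ca] => x _;
  exact: initial_continuous.
Qed.

Lemma letter_set_sep (x y : subshift theta n) :
  x <> y -> exists k, letter_set k x /\ ~ letter_set k y.
Proof.
move=> xy; have [i xyi] : exists i, val x i <> val y i.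
  apply/existsNP => xyi; apply: xy; apply: val_inj; exact/funext.
by exists (pickle (i, val x i)); rewrite /letter_set pickleK; split => // /esym.
Qed.

End Subshift.

(** * Finite levels of the odometer *)

Lemma dvdn_plen (q : nat -> nat) m n : (m <= n)%N -> (plen q m %| plen q n)%N.
Proof.
elim: n => [|n IH]; first by rewrite leqn0 => /eqP ->.
rewrite leq_eqVlt => /predU1P[->//|/IH mn].
by rewrite /plen big_ord_recr; exact: dvdn_mulr.
Qed.

Section Odometer.
Context (q : nat -> nat) (h : nat).

Definition level (n : nat) (y : odometer q * cyclic h) : 'I_(plen q n) * 'I_h :=
  (val y.1 n, y.2).

Lemma level_continuous n :
  continuous (level n : _ -> discrete_topology ('I_(plen q n) * 'I_h)%type).
Proof.
move=> y U /nbhs_singleton Uy.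
have near_eq (T : choiceType) (f : odometer q * cyclic h -> discrete_topology T) :
    continuous f -> \forall y' \near y, f y' = f y.
  move=> /(_ y [set f y]); apply.
  by apply: open_nbhs_nbhs; split => //; exact: discrete_open.
have near1 : \forall y' \near y, val y'.1 n = val y.1 n.
  apply: (near_eq _ (fun y => val y.1 n : discrete_topology 'I_(plen q n))).
  move=> y'; apply: (@continuous_comp _ _ _ (fun y => y.1 : odometer q)
      (fun z => val z n : discrete_topology 'I_(plen q n))).
    exact: cvg_fst.
  apply: (@continuous_comp _ _ _ (val : odometer q -> _)
    (fun z : prod_topology _ => z n)).
    exact: initial_continuous.
  exact: (@proj_continuous _ (fun n => discrete_topology 'I_(plen q n)) n).
have near2 : \forall y' \near y, y'.2 = y.2.
  apply: (near_eq _ (fun y => y.2 : discrete_topology 'I_h)) => y'.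
  exact: cvg_snd.
apply: filterS2 near1 near2 => y' E1 E2.
by rewrite /level /= E1 E2.
Qed.

Lemma level_refine m n y y' : (m <= n)%N -> level n y = level n y' ->
  level m y = level m y'.
Proof.
move=> mn [E1 E2]; congr pair => //; apply: val_inj.
have M (z : odometer q) : val z m = (val z n %% plen q m)%N :> nat.
  have Zz := set_valP z; elim: n mn {E1} => [|n IH].
    by rewrite leqn0 => /eqP ->; rewrite modn_small.
  rewrite leq_eqVlt => /predU1P[->|]; first by rewrite modn_small.
  rewrite ltnS => mn.
  (* Reduction modulo [plen q m] factors through reduction modulo [plen q n], where the
     compatibility of the inverse limit applies. *)
  have <- := modn_dvdm (val z n.+1) (dvdn_plen q mn).
  by rewrite IH// Zz (modn_small (ltn_ord (val z n))).
rewrite /= !M; congr (_ %% _)%N. exact: (f_equal (@nat_of_ord (plen q n)) E1).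
Qed.

Lemma level_sep y y' : (forall n, level n y = level n y') -> y = y'.
Proof.
case: y y' => [z a] [z' a'] E; congr pair; last by case: (E 0%N).
apply: val_inj; apply: functional_extensionality_dep => n.
exact: (f_equal (fun y => y.1) (E n)).
Qed.

Lemma level_rotation n y : level n (rotation y) = rotate (level n y).
Proof. by []. Qed.

End Odometer.

Lemma coprime_plen (q : nat -> nat) (h n : nat) :
  (forall k, coprime h (q k)) -> coprime (plen q n) h.
Proof.
move=> hq; rewrite coprime_sym; apply: (big_ind (coprime h)) => //.
  exact: coprimen1.
by move=> a b ha hb; rewrite coprimeMr ha.
Qed.

(** * Cells of the maximal equicontinuous factor *)

Theorem proposition51 (R : realType) (theta : directive_seq) (q : nat -> nat)
  (theta_tf : torsion_free theta q) (theta_bd : bounded_size theta)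
  (h : nat) (h_height : is_height theta q h)
  (pi : subshift theta 0 -> odometer q * cyclic h)
  (pi_mef : max_equicontinuous_factor_map
              (@shift_on theta 0) (@rotation q h) pi)
  (x0 : subshift theta 0)
  (mu : probability (borel x0) R)
  (mu_inv : invariant_measure mu (@shift_on theta 0))
  (mu_erg : ergodic mu (@shift_on theta 0))
  (regular : forall nu : probability (borel x0) R,
     invariant_measure nu (@shift_on theta 0) ->
     pushforward nu (pi : borel x0 -> borel (pi x0))
       [set y | exists! x, pi x = y] = 1%E)
  (u : forall n, fullshift (theta n)) (u_coherent : coherent q u)
  (bar : directive_seq) (tau : forall n, bar n -> seq (theta n))
  (bar_base : pure_base q h u tau)
  (column1 : naive_column_number bar q = 1%N) :
  uniquely_ergodic R (X := borel x0) (@shift_on theta 0) /\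
  discrete_spectrum_continuous_eigenfunctions mu (@shift_on theta 0).
Proof.
have [_ [pi_cont _ pi_shift] _] := pi_mef.
have [_ hq _] := h_height.
pose c n (x : subshift theta 0) := level n (pi x).
have c_open n i : open [set x | c n x = i].
  apply: (@open_comp _ _ (level n \o pi : _ -> discrete_topology _) [set i]);
    last exact: discrete_open.
  move=> x _; apply: continuous_comp; [exact: pi_cont|exact: level_continuous].
have c_refine m n x y : (m <= n)%N -> c n x = c n y -> c m x = c m y.
  exact: level_refine.
have c_shift n x : c n (shift_on x) = rotate (c n x).
  by rewrite /c pi_shift level_rotation.
have c_meas n i : @measurable _ (borel x0) [set x | c n x = i].
  exact: measurable_open.
(* Since the levels separate points of the factor, [singleton_fibres c] is the preimage under [pi]
   of the set of points with exactly one preimage. *)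
have single (nu : probability (borel x0) R) :
    invariant_measure nu (@shift_on theta 0) -> nu (singleton_fibres c) = 1%E.
  move=> /regular <-; congr (nu _); apply/seteqP; split => x /=.
    move=> xS; exists x; split => // y /esym yx.
    by apply/esym/xS => n; rewrite /c yx.
  move=> [x' [px' ux']] y cyx.
  have pyx : pi y = pi x by exact: level_sep.
  by rewrite -(ux' y pyx) -(ux' x erefl).
have cells (nu : probability (borel x0) R) n i :
    invariant_measure nu (@shift_on theta 0) ->
    nu [set x | c n x = i] = (#|{: 'I_(plen q n) * 'I_h}|%:R^-1)%:E.
  move=> nu_inv; apply: (invariant_cells (X := borel x0) (c := c n)
    (r := @rotate (plen q n) h) nu_inv) => //.
  - exact: c_meas.
  - exact: c_shift.
  - exact: rotate_inj.
  - by move=> j k; apply: rotate_transitive; exact: coprime_plen.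
have cX := @compact_subshift theta 0.
have DC := @letter_set_clopen theta 0.
have Ds := @letter_set_sep theta 0.
split.
  exists mu => // nu nu_inv A mA.
  apply: (eq_measure_singleton_fibres c_open c_refine cX DC Ds) => //.
  - exact: single.
  - exact: single.
  - by move=> n i; rewrite !cells.
apply: (discrete_spectrum_cells (c := c)) => //.
- move=> f mf if2; apply: (cell_approx_borel c_open c_refine cX DC Ds) => //.
  exact: single.
(* The label of [x0] inhabits the ordinal types, so their sizes are positive. *)
- by move=> n; case: (c n x0) => -[a /(leq_ltn_trans (leq0n _))].
- by case: (c 0%N x0) => _ [a /(leq_ltn_trans (leq0n _))].
Qed.
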